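(* Let $p\ge 1$ and $N>p$ be integers. Let $L^*\in\mathbb{R}^{p\times p}$ be the reduced Laplacian of a connected, undirected, weighted graph on $p+1$ nodes (a symmetric positive definite matrix), and let $\Theta_x\in\mathbb{R}^{p\times p}$ be a known symmetric positive definite matrix. Let $y_1,\dots,y_N$ be i.i.d. random vectors in $\mathbb{R}^p$ distributed as $y=(L^* )^{-1}x$ with $x\sim\mathcal{N}(0,\Theta_x^{-1})$, and let $$S=\frac1N\sum_{t=1}^N y_t y_t^{\mathsf T}$$ be the sample covariance matrix. Then, with probability one, the unregularized problem $$\underset{L\in\mathcal{S}_p^{++}}{\text{minimize}}\quad \operatorname{Tr}(S L\Theta_x L)-2\log\det(L)$$ has a unique global minimizer $\hat L$ (the unrestricted maximum likelihood estimator), and it is given by $$\hat L=S^{-1/2}\left(S^{1/2}\,\Theta_x^{-1}\,S^{1/2}\right)^{1/2}S^{-1/2}.$$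
   Context: $\mathcal{S}_p^{++}$ denotes the set of real symmetric positive definite $p\times p$ matrices. For a symmetric positive definite matrix $A$, $A^{1/2}$ denotes its unique symmetric positive definite square root, and $A^{-1/2}=(A^{1/2})^{-1}$. Reduced Laplacian: consider an undirected connected graph with node set $\{0,1,\dots,p\}$, edge set $E$ and symmetric weights $a_{ij}=a_{ji}\ge 0$ with $a_{ij}\neq 0$ (for $i\ne j$) if and only if $(i,j)\in E$. The full Laplacian is the $(p+1)\times(p+1)$ matrix with off-diagonal entries $-a_{ij}$ and diagonal entries $\sum_{k\ne i}a_{ik}$. The reduced Laplacian $L^*$ is obtained by deleting the row and column of node $0$; it is symmetric positive definite. The problem in the claim is the case $\lambda=0$ of the $\ell_1$-regularized maximum likelihood problem of minimizing $\operatorname{Tr}(SL\Theta_xL)-2\log\det(L)+\lambda\sum_{i\ne j}|L_{ij}|$ over $L\in\mathcal{S}_p^{++}$. *)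

(* Defs.v *)
From HB Require Import structures.
From mathcomp Require Import all_boot all_order all_algebra.
From mathcomp Require Import all_classical all_reals all_analysis.
Import Order.TTheory GRing.Theory Num.Theory.
Import numFieldNormedType.Exports.

Set Implicit Arguments.
Unset Strict Implicit.
Unset Printing Implicit Defensive.

Local Open Scope classical_set_scope.
Local Open Scope ring_scope.

Definition spd (R : realType) (n : nat) : set 'M[R]_n :=
  [set A | A \is symmetricmx /\
           forall v : 'cV[R]_n, v != 0 -> 0 < (v^T *m A *m v) 0 0].

(* The SPD square root of A; the value is junk (0) when there is none, that is,
   when A is not itself SPD. *)
Definition sqrtmx (R : realType) (n : nat) (A : 'M[R]_n) : 'M[R]_n :=
  xget 0 [set B | spd B /\ B *m B = A].

(* Graph on the nodes 0, ..., p with edge relation E and weights a; the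
   diagonal of a plays no role. *)
Definition weighted_graph (R : realType) (p : nat)
    (E : rel 'I_p.+1) (a : 'M[R]_p.+1) : Prop :=
  [/\ symmetric E, irreflexive E,
      forall i j, a i j = a j i,
      forall i j, 0 <= a i j
    & forall i j, i != j -> (a i j != 0) = E i j].

Definition connected_graph (p : nat) (E : rel 'I_p.+1) : Prop :=
  forall i j, connect E i j.

Definition laplacian (R : realType) (p : nat) (a : 'M[R]_p.+1) : 'M[R]_p.+1 :=
  \matrix_(i, j) (if i == j then \sum_(k | k != i) a i k else - a i j).

Definition reduced_laplacian (R : realType) (p : nat) (a : 'M[R]_p.+1) :
  'M[R]_p := row' ord0 (col' ord0 (laplacian a)).

(* R^p, as column vectors, with its Borel sigma-algebra. *)
Definition borel_cV (R : realType) (p : nat) :=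
  g_sigma_algebraType (@open 'cV[R]_p).

(* The univariate normal law with mean m and variance v. The library's
   normal_prob takes the standard deviation, and for standard deviation 0 it is
   not the Dirac mass but the uniform law on [0, 1]. *)
Definition normal_law (R : realType) (m v : R) : set R -> \bar R :=
  fun A => if v == 0 then \d_m A else normal_prob m (Num.sqrt v) A.

(* X ~ N(mu, Sigma): every linear form <u, X> is univariate normal with mean
   <u, mu> and variance <u, Sigma u>. *)
Definition gaussian_vector (d : measure_display) (T : measurableType d)
    (R : realType) (P : probability T R) (p : nat)
    (X : {RV P >-> borel_cV R p}) (mu : 'cV[R]_p) (Sigma : 'M[R]_p) : Prop :=
  forall (u : 'cV[R]_p) (A : set R), measurable A ->
    P [set w | A ((u^T *m (X w : 'cV[R]_p)) 0 0)] =
    normal_law ((u^T *m mu) 0 0) ((u^T *m Sigma *m u) 0 0) A.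

(* The events range over all indices at once: the product rule for subfamilies
   is the case B t = setT for the other indices. *)
Definition mutually_independent (d d' : measure_display)
    (T : measurableType d) (T' : measurableType d') (R : realType)
    (P : probability T R) (N : nat) (X : 'I_N -> {RV P >-> T'}) : Prop :=
  forall B : 'I_N -> set T', (forall t, measurable (B t)) ->
    P [set w | forall t, B t (X t w)] =
    (\prod_(t < N) P [set w | B t (X t w)])%E.

Definition sample_cov (R : realType) (p N : nat) (y : 'I_N -> 'cV[R]_p) :
  'M[R]_p := N%:R^-1 *: \sum_(t < N) y t *m (y t)^T.

Definition mle_objective (R : realType) (p : nat) (S Theta L : 'M[R]_p) : R :=
  \tr (S *m L *m Theta *m L) - 2 * ln (\det L).

Definition global_minimizer (R : realType) (T : Type) (C : set T) (f : T -> R)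
    (x : T) : Prop :=
  C x /\ forall z, C z -> f x <= f z.

(* Main.v *)
Require Import Defs.
From HB Require Import structures.
From mathcomp Require Import all_boot all_order all_algebra.
From mathcomp Require Import all_classical all_reals all_analysis.
From mathcomp Require Import measurable_realfun complex ring lra.
Import Order.TTheory GRing.Theory Num.Theory.
Import numFieldNormedType.Exports.

Set Implicit Arguments.
Unset Strict Implicit.
Unset Printing Implicit Defensive.

Local Open Scope classical_set_scope.
Local Open Scope ring_scope.

(** With [W = S^(1/2) L Theta L S^(1/2)], the objective equals
    [tr W - ln det W] up to a constant not depending on [L]. Over SPD matrices
    this is minimal exactly at [W = 1] (compare [x - ln x] with [1] at every
    eigenvalue), and [W = 1] says that [S^(1/2) L S^(1/2)] is an SPD square root
    of [S^(1/2) Theta^-1 S^(1/2)]; such a root exists and is unique.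

    That [S] is almost surely SPD needs [y_1, ..., y_p] almost surely linearly
    independent. In a linear relation, dividing by the largest coefficient gives
    some [y_t] as a combination of the others with coefficients in [-1, 1].
    Rounding the other vectors to a grid of step [eps] then puts [y_t] in a
    strip of width [O(eps)] around a hyperplane spanned by grid points. Each
    grid configuration is a product event, so by independence and the Gaussian
    density bound, uniform over directions, the relation has probability
    [O(eps)], and no product measure is needed. *)

(** * Symmetric positive definite matrices *)

Lemma symmetricmxP (R : realType) n (A : 'M[R]_n) :
  reflect (A^T = A) (A \is symmetricmx).
Proof.
apply: (iffP (is_hermitianmxP _ _ _)); rewrite expr0 scale1r map_mx_id // => ->.
Qed.

(* The diagonalization over [R[i]] of a matrix that is real with real
   eigenvalues yields a real one. *)
Lemma symmetric_diagonalizable (R : realType) n (A : 'M[R]_n) : A^T = A ->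
  exists P d, P \in unitmx /\ A = invmx P *m diag_mx d *m P.
Proof.
move=> Asym.
pose f := real_complex R.
have fM m1 m2 (X : 'M[R]_(m1, m2)) : map_mx f X \is a mxOver Num.real.
  by apply/mxOverP => i j; rewrite mxE; apply/complex_realP; exists (X i j).
have fK m1 m2 (X : 'M[R[i]]_(m1, m2)) : X \is a mxOver Num.real ->
    exists Y : 'M[R]_(m1, m2), X = map_mx f Y.
  move=> /mxOverP XR; exists (map_mx (@complex.Re R) X).
  by apply/matrixP => i j; rewrite !mxE; apply/esym/RRe_real.
have fI m1 m2 : injective (map_mx f : 'M[R]_(m1, m2) -> _).
  move=> X Y /matrixP XY; apply/matrixP => i j.
  by have := XY i j; rewrite !mxE => /complexI.
have Aherm : map_mx f A \is hermsymmx.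
  apply: realsym_hermsym (fM _ _ A); apply/is_hermitianmxP.
  by rewrite expr0 scale1r map_mx_id // -{1}Asym; apply/matrixP => i j; rewrite !mxE.
have [d fd] := fK _ _ _ (hermitian_spectral_diag_real Aherm).
have AE := orthomx_spectralP (hermitian_normalmx Aherm).
have [] := real_similar _ (fM _ _ A) (fM _ _ (diag_mx d)).
  exists (spectralmx (map_mx f A)); first exact: spectral_unit.
  apply/similarP; first exact: spectral_unit.
  by rewrite map_diag_mx -fd [X in _ *m X]AE !mulmxA mulmxV ?mul1mx ?spectral_unit.
move=> _ /andP[/fK[P ->]]; rewrite /= map_unitmx => Pu.
move=> /similarP; rewrite map_unitmx => /(_ Pu); rewrite -!map_mxM => /fI PA.
by exists P, d; split=> //; rewrite -mulmxA -PA mulmxA mulVmx ?mul1mx.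
Qed.

Lemma dotv_ge0 (R : realType) n (v : 'cV[R]_n) : 0 <= (v^T *m v) 0 0.
Proof. by rewrite mxE sumr_ge0 // => i _; rewrite mxE -expr2 sqr_ge0. Qed.

Lemma dotv_gt0 (R : realType) n (v : 'cV[R]_n) : v != 0 -> 0 < (v^T *m v) 0 0.
Proof.
move=> v0; rewrite lt_def dotv_ge0 andbT; apply: contra v0.
rewrite mxE psumr_eq0; last by move=> i _; rewrite mxE -expr2 sqr_ge0.
move=> /allP v0; apply/eqP/colP => i; rewrite mxE.
by have := v0 i (mem_index_enum i); rewrite mxE mulf_eq0 orbb => /eqP.
Qed.

Section spd_theory.
Variables (R : realType) (n : nat).
Implicit Types A B C L : 'M[R]_n.

Lemma spd_sym A : spd A -> A^T = A.
Proof. by case=> /symmetricmxP. Qed.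

Lemma spd_mulmx_neq0 A (v : 'cV[R]_n) : spd A -> v != 0 -> A *m v != 0.
Proof.
move=> [_ A0] /A0; rewrite -mulmxA; apply: contraTneq => ->.
by rewrite mulmx0 mxE ltxx.
Qed.

Lemma unitmx_ker0 A : (forall v : 'cV_n, v != 0 -> A *m v != 0) -> A \in unitmx.
Proof.
move=> A0; rewrite -unitmx_tr unitmxE unitfE; apply/negP => /eqP/eqP/det0P[v v0].
move=> /(congr1 trmx); rewrite trmx_mul trmxK trmx0 => /eqP; apply/negP.
by apply: A0; rewrite -(inj_eq (@trmx_inj _ _ _)) trmxK trmx0.
Qed.

Lemma spd_unitmx A : spd A -> A \in unitmx.
Proof. by move=> sA; apply: unitmx_ker0 => v; exact: spd_mulmx_neq0. Qed.

Lemma unitmx_mulmx_neq0 A (v : 'cV[R]_n) : A \in unitmx -> v != 0 -> A *m v != 0.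
Proof.
by move=> Au; apply: contra_neq => Av; rewrite -[v](mulKmx Au) Av mulmx0.
Qed.

Lemma spd_congr A C : C \in unitmx -> spd A -> spd (C^T *m A *m C).
Proof.
move=> Cu sA; have [_ A0] := sA; split.
  by apply/symmetricmxP; rewrite !trmx_mul trmxK (spd_sym sA) mulmxA.
move=> v v0; have -> : v^T *m (C^T *m A *m C) *m v = (C *m v)^T *m A *m (C *m v).
  by rewrite trmx_mul !mulmxA.
by apply: A0; exact: unitmx_mulmx_neq0.
Qed.

Lemma spd1 : spd (1%:M : 'M[R]_n).
Proof.
split; first by apply/symmetricmxP; rewrite trmx1.
by move=> v; rewrite mulmx1; exact: dotv_gt0.
Qed.

Lemma spd_gram C : C \in unitmx -> spd (C^T *m C).
Proof. by move=> Cu; rewrite -[C^T]mulmx1; apply: spd_congr => //; exact: spd1. Qed.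

Lemma spd_inv A : spd A -> spd (invmx A).
Proof.
move=> sA; have Au := spd_unitmx sA.
have -> : invmx A = (invmx A)^T *m A *m invmx A.
  by rewrite -mulmxA mulmxV // mulmx1 trmx_inv (spd_sym sA).
by apply: spd_congr => //; rewrite unitmx_inv.
Qed.

(** Row [i] of [P] is a left eigenvector of [A], so the form of [A] at its transpose [v] is [d 0 i]
    times the squared norm of [v]. *)
Lemma spd_diagonalizable A : spd A -> exists P d,
  [/\ P \in unitmx, A = invmx P *m diag_mx d *m P & forall i, 0 < d 0 i].
Proof.
move=> sA; have [P [d [Pu AE]]] := symmetric_diagonalizable (spd_sym sA).
exists P, d; split=> // i.
pose v := (row i P)^T.
have v0 : v != 0.
  apply/eqP => /(congr1 (fun v => v^T *m invmx P)).
  rewrite trmxK -row_mul mulmxV // trmx0 mul0mx => /rowP/(_ i).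
  by rewrite !mxE eqxx => /eqP; rewrite oner_eq0.
have := sA.2 v v0; have -> : v^T *m A = d 0 i *: v^T.
  rewrite trmxK -row_mul AE !mulmxA mulmxV // mul1mx.
  by apply/rowP => j; rewrite mxE mul_diag_mx !mxE.
by rewrite -scalemxAl mxE pmulr_lgt0 // dotv_gt0.
Qed.

Lemma trace_diagonalized (P : 'M[R]_n) d :
  P \in unitmx -> \tr (invmx P *m diag_mx d *m P) = \sum_i d 0 i.
Proof. by move=> Pu; rewrite mxtrace_mulC mulmxA mulmxV // mul1mx mxtrace_diag. Qed.

Lemma det_diagonalized (P : 'M[R]_n) d :
  P \in unitmx -> \det (invmx P *m diag_mx d *m P) = \prod_i d 0 i.
Proof.
move=> Pu; rewrite !det_mulmx mulrC mulrA -det_mulmx mulmxV // det1 mul1r.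
exact: det_diag.
Qed.

Lemma spd_det A : spd A -> 0 < \det A.
Proof.
move=> /spd_diagonalizable[P [d [Pu -> d0]]]; rewrite det_diagonalized //.
by apply: prodr_gt0 => i _; exact: d0.
Qed.

Lemma ln_le_subr1 (x : R) : 0 < x -> ln x <= x - 1.
Proof. by move=> x0; rewrite lerBrDl -[leRHS]lnK ?posrE // expR_ge1Dx. Qed.

Lemma ln_lt_subr1 (x : R) : 0 < x -> x != 1 -> ln x < x - 1.
Proof.
move=> x0 x1; rewrite ltrBrDl -[ltRHS]lnK ?posrE // expR_gt1Dx //.
by rewrite ln_eq0.
Qed.

Lemma trace_sub_lndet A : spd A ->
  n%:R <= \tr A - ln (\det A) ?= iff (A == 1%:M).
Proof.
move=> /spd_diagonalizable[P [d [Pu AE d0]]].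
rewrite {1}AE trace_diagonalized // {1}AE det_diagonalized //.
have -> : ln (\prod_i d 0 i) = \sum_i ln (d 0 i).
  (* Positivity of the partial products is carried through the induction because [lnM] requires
     it. *)
  have [_ ->//] : 0 < \prod_i d 0 i /\ ln (\prod_i d 0 i) = \sum_i ln (d 0 i).
  elim/big_rec2: _ => [|i y1 y2 _ [y20 yE]]; first by rewrite ln1 ltr01.
  by rewrite mulr_gt0 // lnM ?posrE // yE.
rewrite -sumrB.
have lb i : 1 <= d 0 i - ln (d 0 i) ?= iff (d 0 i == 1).
  split; first by have := ln_le_subr1 (d0 i); lra.
  have [->|d1] := eqVneq (d 0 i) 1; first by rewrite ln1 subr0 eqxx.
  by apply/negbTE; have := ln_lt_subr1 (d0 i) d1; rewrite neq_lt; lra.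
have [le_sum eq_sum] := leif_sum (fun i (_ : predT i) => lb i).
rewrite big_const_ord iter_addr_0 in le_sum eq_sum.
split=> //; rewrite eq_sum; apply/forallP/eqP => [/= d1|A1 i /=].
  rewrite AE (_ : diag_mx d = 1%:M) ?mulmx1 ?mulVmx //.
  apply/matrixP => i j; rewrite !mxE.
  by have [->|//] := eqVneq i j; rewrite (eqP (d1 j)).
have := congr1 (fun X => P *m X *m invmx P) AE.
rewrite A1 mulmx1 mulmxV // !mulmxA mulmxV // mul1mx mulmxK //.
by move=> /matrixP/(_ i i); rewrite !mxE eqxx !mulr1n => <-.
Qed.

(* [P P^T] commutes with [diag_mx d] because [A] is symmetric, hence with every
   function of it, so that [invmx P *m diag_mx (f d) *m P] is symmetric. *)
Lemma diag_fun_sym (P : 'M[R]_n) d (f : R -> R) : P \in unitmx ->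
  (invmx P *m diag_mx d *m P)^T = invmx P *m diag_mx d *m P ->
  (invmx P *m diag_mx (map_mx f d) *m P)^T = invmx P *m diag_mx (map_mx f d) *m P.
Proof.
move=> Pu; pose G := P *m P^T.
have comm (e : 'rV[R]_n) : (invmx P *m diag_mx e *m P)^T = invmx P *m diag_mx e *m P <->
    G *m diag_mx e = diag_mx e *m G.
  rewrite !trmx_mul tr_diag_mx trmx_inv mulmxA; split => [E|E].
    have := congr1 (fun X => P *m X *m P^T) E; rewrite /G !mulmxA mulmxV // mul1mx.
    by rewrite mulmxKV // unitmx_tr.
  apply: (can_inj (mulKmx Pu)); rewrite !mulmxA mulmxV // mul1mx -/G E /G.
  by rewrite mulmxA mulmxK // unitmx_tr.
move=> /comm/matrixP E; apply/comm/matrixP => i j; have := E i j.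
rewrite !mul_mx_diag !mul_diag_mx !mxE mulrC => /eqP.
rewrite -subr_eq0 -mulrBl mulf_eq0 subr_eq0 => /orP[/eqP ->|/eqP ->].
  by rewrite mulrC.
by rewrite mulr0 mul0r.
Qed.

Lemma spd_sqrt A : spd A -> exists B, spd B /\ B *m B = A.
Proof.
move=> sA; have [P [d [Pu AE d0]]] := spd_diagonalizable sA.
(* [F] is the functional calculus of [A]. It is multiplicative, and for positive [f] the matrix
   [F f] is the Gram matrix of the invertible [F g] with [g] the square root of [f], hence SPD. *)
pose F f := invmx P *m diag_mx (map_mx f d) *m P.
have Fsym f : (F f)^T = F f by apply: diag_fun_sym => //; rewrite -AE spd_sym.
have FM f g : F f *m F g = F (fun x => f x * g x).
  rewrite /F !mulmxA mulmxK // -[_ *m diag_mx _ *m diag_mx _]mulmxA mulmx_diag.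
  by congr (_ *m diag_mx _ *m _); apply/rowP => i; rewrite !mxE.
have Fpos f : (forall x, 0 < x -> 0 < f x) -> spd (F f).
  move=> f0; pose g := fun x => Num.sqrt (f x).
  have -> : F f = (F g)^T *m F g.
    rewrite Fsym FM /F; congr (_ *m diag_mx _ *m _); apply/rowP => i.
    by rewrite !mxE -expr2 sqr_sqrtr // ltW // f0.
  apply: spd_gram; rewrite /F !unitmx_mul Pu unitmx_inv Pu andbT /=.
  rewrite unitmxE det_diag unitfE; apply/prodf_neq0 => i _.
  by rewrite mxE gt_eqF // sqrtr_gt0 f0.
exists (F Num.sqrt); split; first by apply: Fpos => x; rewrite sqrtr_gt0.
rewrite FM AE /F; congr (_ *m diag_mx _ *m _); apply/rowP => i.
by rewrite !mxE -expr2 sqr_sqrtr // ltW.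
Qed.

(* With [D = A - B], [A^2 = B^2] reads [A D + D B = 0], and the trace of
   [D (A D + D B)] is a sum of values of the forms [A] and [B] on columns of [D]. *)
Lemma spd_sqrt_inj A B : spd A -> spd B -> A *m A = B *m B -> A = B.
Proof.
move=> sA sB AB; pose D := A - B.
have Dsym : D^T = D by rewrite linearB /= !spd_sym.
have DE : A *m D + D *m B = 0.
  by rewrite /D mulmxBr mulmxBl AB addrA subrK subrr.
have trE C : \tr (D *m C *m D) = \sum_j ((col j D)^T *m C *m col j D) 0 0.
  by apply: eq_bigr => j _; rewrite tr_col Dsym -!row_mul !mxE;
    apply: eq_bigr => k _; rewrite !mxE.
have ge0 C (v : 'cV[R]_n) : spd C -> 0 <= (v^T *m C *m v) 0 0.
  move=> [_ C0]; have [->|/C0/ltW//] := eqVneq v 0.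
  by rewrite mulmx0 mxE.
have trD : \tr (D *m A *m D) + \tr (D *m B *m D) = 0.
  rewrite [X in _ + X]mxtrace_mulC mulmxA -mxtraceD -mulmxA.
  by rewrite -[X in _ + X]mulmxA -mulmxDr DE mulmx0 mxtrace0.
have trA0 : \tr (D *m A *m D) = 0.
  have : 0 <= \tr (D *m A *m D) by rewrite trE sumr_ge0 // => j _; exact: ge0.
  have : 0 <= \tr (D *m B *m D) by rewrite trE sumr_ge0 // => j _; exact: ge0.
  by move: trD; lra.
apply/eqP; rewrite -subr_eq0 -/D; apply/eqP/matrixP => i j.
apply/eqP; rewrite [X in _ == X]mxE; move/eqP: trA0; rewrite trE psumr_eq0; last first.
  by move=> k _; exact: ge0.
move=> /allP/(_ j (mem_index_enum j)); apply: contraTeq => Dij.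
rewrite implyTb gt_eqF // sA.2 //; apply: contraNneq Dij => /colP/(_ i).
by rewrite !mxE => ->; rewrite eqxx.
Qed.

Lemma sqrtmxP A : spd A -> spd (sqrtmx A) /\ sqrtmx A *m sqrtmx A = A.
Proof.
move=> /spd_sqrt[B sB].
exact: (@xgetPex _ 0 [set B | spd B /\ B *m B = A] (ex_intro _ B sB)).
Qed.

End spd_theory.

(** * Maximum likelihood for a positive definite sample covariance *)

(** A one-sided inverse of a square matrix is two-sided, so the last factor [M] can be moved to the
    front. *)
Lemma mulmx_invmx_mulmx_eq1 (R : realType) n (K M : 'M[R]_n) :
  K \in unitmx -> M \in unitmx ->
  M *m invmx K *m M = 1%:M <-> M *m M = K.
Proof.
move=> Ku Mu; split=> [E|<-].
  have /(congr1 (fun X => X *m K)) := mulmx1C E.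
  by rewrite mul1mx mulmxA mulmxKV.
have Iu : invmx (M *m M) *m M = invmx M.
  apply: (can_inj (mulmxK Mu)); rewrite -mulmxA mulVmx ?mulVmx //.
  by rewrite unitmx_mul Mu.
by rewrite -mulmxA Iu mulmxV.
Qed.

Section mle.
Variables (R : realType) (n : nat) (S Theta : 'M[R]_n).
Hypotheses (sS : spd S) (sTheta : spd Theta).

Let Sh := sqrtmx S.
Let Q := sqrtmx (Sh *m invmx Theta *m Sh).
Let W L := Sh *m L *m Theta *m L *m Sh.

Let sSh : spd Sh. Proof. exact: (sqrtmxP sS).1. Qed.
Let ShE : Sh *m Sh = S. Proof. exact: (sqrtmxP sS).2. Qed.
Let Shu : Sh \in unitmx. Proof. exact: spd_unitmx. Qed.
Let sK : spd (Sh *m invmx Theta *m Sh).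
Proof. by rewrite -{1}(spd_sym sSh); apply: spd_congr => //; exact: spd_inv. Qed.
Let sQ : spd Q. Proof. exact: (sqrtmxP sK).1. Qed.
Let QE : Q *m Q = Sh *m invmx Theta *m Sh. Proof. exact: (sqrtmxP sK).2. Qed.

Let Lhat := invmx Sh *m Q *m invmx Sh.

Let sLhat : spd Lhat.
Proof.
rewrite /Lhat -{1}(spd_sym (spd_inv sSh)); apply: spd_congr => //.
by rewrite unitmx_inv.
Qed.

Let sW L : spd L -> spd (W L).
Proof.
move=> sL; have -> : W L = (L *m Sh)^T *m Theta *m (L *m Sh).
  by rewrite trmx_mul !spd_sym // !mulmxA.
by apply: spd_congr; rewrite // unitmx_mul !spd_unitmx.
Qed.

(** This form [M K^-1 M] turns [W L = 1] into the square root equation [M M = K] for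
    [M = Sh L Sh]. *)
Let WE L : W L = (Sh *m L *m Sh) *m invmx (Sh *m invmx Theta *m Sh) *m (Sh *m L *m Sh).
Proof.
have Tu := spd_unitmx sTheta.
have -> : invmx (Sh *m invmx Theta *m Sh) = invmx Sh *m Theta *m invmx Sh.
  have Ku := spd_unitmx sK.
  apply: (can_inj (mulKmx Ku)); rewrite mulmxV // !mulmxA mulmxK //.
  by rewrite mulmxKV // mulmxV.
by rewrite !mulmxA mulmxK // mulmxKV.
Qed.

Let W_eq1 L : spd L -> W L = 1%:M <-> L = Lhat.
Proof.
move=> sL; have sM : spd (Sh *m L *m Sh).
  by rewrite -{1}(spd_sym sSh); apply: spd_congr.
rewrite WE; apply: (iff_trans (mulmx_invmx_mulmx_eq1 (spd_unitmx sK) (spd_unitmx sM))).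
rewrite -QE; split=> [/(spd_sqrt_inj sM sQ) QM|->].
  by rewrite /Lhat -QM !mulmxA mulVmx // mul1mx mulmxK.
suff -> : Sh *m Lhat *m Sh = Q by [].
by rewrite /Lhat !mulmxA mulmxV // mul1mx mulmxKV.
Qed.

Lemma mle_unique_minimizer :
  unique (global_minimizer (@spd R n) (mle_objective S Theta)) Lhat.
Proof.
(* Cyclicity of the trace moves one factor [Sh] to the end, and [det (W L)] is
   [det S * det Theta * (det L)^2]. *)
have objE L : spd L -> mle_objective S Theta L =
    \tr (W L) - ln (\det (W L)) + (ln (\det S) + ln (\det Theta)).
  move=> sL; rewrite /mle_objective -[in \tr _]ShE -!mulmxA mxtrace_mulC !mulmxA -/(W L).
  rewrite /W !det_mulmx -ShE det_mulmx !lnM ?posrE ?mulr_gt0 ?spd_det //.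
  by ring.
have Lhat_val : \tr (W Lhat) - ln (\det (W Lhat)) = n%:R.
  by rewrite (W_eq1 sLhat).2 // mxtrace1 det1 ln1 subr0.
split.
  split=> // L sL; rewrite !objE // lerD2r Lhat_val.
  exact: (trace_sub_lndet (sW sL)).1.
(* Another minimizer also attains the lower bound [n], and the equality case forces [W L = 1]. *)
move=> L [sL Lmin]; apply/esym/(W_eq1 sL).
have := Lmin _ sLhat; rewrite !objE // lerD2r Lhat_val.
by rewrite (ge_leif (trace_sub_lndet (sW sL))) => /eqP.
Qed.

End mle.

(** * Reduced Laplacians *)

(* If [L v = 0] and [v] is extended by [0] at node [0], then the Dirichlet energy
   vanishes, so the extension is constant along edges, hence zero. *)
Lemma reduced_laplacian_unitmx (R : realType) (p : nat) (E : rel 'I_p.+1)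
    (a : 'M[R]_p.+1) :
  weighted_graph E a -> connected_graph E -> reduced_laplacian a \in unitmx.
Proof.
move=> [_ Eirr asym a_ge0 aE] conn; apply: unitmx_ker0 => v; apply: contra_neq => Lv.
pose w i := if unlift ord0 i is Some j then v j 0 else 0.
pose b i k := if k != i then a i k else 0.
have bC i k : b i k = b k i by rewrite /b eq_sym asym.
have w0 : w ord0 = 0 by rewrite /w unlift_none.
(* Away from node 0 the sum is a coordinate of [L v = 0]; at node 0, where there is no such
   equation, the factor [w i] vanishes. *)
have harm i : w i * \sum_k b i k * (w i - w k) = 0.
  case: (unliftP ord0 i) => [j ->|->]; last by rewrite w0 mul0r.
  suff -> : \sum_k b (lift ord0 j) k * (w (lift ord0 j) - w k) =
      (reduced_laplacian a *m v) j 0 by rewrite Lv mxE mulr0.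
  transitivity (\sum_k laplacian a (lift ord0 j) k * w k).
    under eq_bigr do rewrite mulrBr.
    rewrite sumrB -mulr_suml [RHS](bigD1 (lift ord0 j)) //= mxE eqxx.
    congr (_ * _ + _); first by rewrite [RHS]big_mkcond.
    rewrite [in RHS]big_mkcond -sumrN; apply: eq_bigr => k _.
    by rewrite /b mxE eq_sym; case: eqP => _; rewrite ?mul0r ?oppr0 // mulNr.
  rewrite big_ord_recl w0 mulr0 add0r mxE; apply: eq_bigr => k _.
  by rewrite /w liftK !mxE.
have energy : \sum_i \sum_k b i k * (w i - w k) ^+ 2 = 0.
  (* [e1] and [e2] differ by exchanging [i] and [k]; their termwise sum is the square. *)
  have e1 : \sum_i \sum_k w i * (b i k * (w i - w k)) = 0.
    by apply: big1 => i _; rewrite -mulr_sumr harm.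
  have e2 : \sum_i \sum_k w k * (b i k * (w k - w i)) = 0.
    rewrite exchange_big /= -[RHS]e1; apply: eq_bigr => i _; apply: eq_bigr => k _.
    by rewrite bC.
  have := congr2 +%R e1 e2; rewrite addr0; apply: etrans.
  rewrite -[RHS]big_split /=; apply: eq_bigr => i _.
  by rewrite -[RHS]big_split /=; apply: eq_bigr => k _ /=; ring.
have b_ge0 i k : 0 <= b i k by rewrite /b; case: ifP.
have wE i k : E i k -> w i = w k.
  move=> Eik; have ik : i != k by apply: contraTneq Eik => ->; rewrite Eirr.
  have term_ge0 i' k' : 0 <= b i' k' * (w i' - w k') ^+ 2 by rewrite mulr_ge0 ?sqr_ge0.
  move/eqP: energy; rewrite psumr_eq0; last by move=> *; exact: sumr_ge0.
  move=> /allP/(_ i (mem_index_enum i)); rewrite implyTb psumr_eq0 //.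
  move=> /allP/(_ k (mem_index_enum k)); rewrite implyTb mulf_eq0 /b [k == i]eq_sym ik.
  by rewrite -[_ == 0]negbK aE // Eik /= sqrf_eq0 subr_eq0 => /eqP.
have w_eq0 i : w i = 0.
  have /connectP[s ps ->] := conn ord0 i.
  elim: s ord0 w0 ps => [//|j s IH] k wk /= /andP[/wE kj].
  by apply: IH; rewrite -kj.
by apply/colP => j; have := w_eq0 (lift ord0 j); rewrite /w liftK !mxE.
Qed.

(** * Linear independence of independent random vectors *)

Section borel_column_vectors.
Variables (R : realType) (p : nat).

Lemma measurable_cV_coord (i : 'I_p) :
  measurable_fun setT (fun v : borel_cV R p => (v : 'cV[R]_p) i 0).
Proof.
apply: (measurability _ (RGenOpens.measurableE R)) => _ [_ [a [b ->] <-]].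
rewrite setTI; apply: sub_sigma_algebra.
by apply: open_comp (interval_open _ _) => // v _; exact: coord_continuous.
Qed.

Lemma measurable_cV_dot (u : 'cV[R]_p) :
  measurable_fun setT (fun v : borel_cV R p => (u^T *m (v : 'cV[R]_p)) 0 0).
Proof.
under eq_fun do rewrite mxE; apply: measurable_sum => i.
by under eq_fun do rewrite mxE; apply: measurable_funM => //; exact: measurable_cV_coord.
Qed.

Lemma measurable_strip (u : 'cV[R]_p) (r : R) :
  measurable ([set v | `|(u^T *m (v : 'cV[R]_p)) 0 0| <= r] : set (borel_cV R p)).
Proof.
rewrite -[X in measurable X]setTI.
have -> : [set v : borel_cV R p | `|(u^T *m (v : 'cV[R]_p)) 0 0| <= r] =
    (fun v : borel_cV R p => (u^T *m (v : 'cV[R]_p)) 0 0) @^-1` `[- r, r].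
  by apply/seteqP; split=> v /=; rewrite in_itv /= ler_norml.
by apply: measurable_cV_dot => //; exact: measurable_itv.
Qed.

(** Integer coordinates make the set of cells countable, so that grid configurations can be
    enumerated. *)
Definition cell (eps : R) (v : 'cV[R]_p) : 'cV[int]_p :=
  \col_i Num.floor (v i 0 / eps).

Definition corner (eps : R) (z : 'cV[int]_p) : 'cV[R]_p :=
  \col_i ((z i 0)%:~R * eps).

Lemma cell_corner_le (eps : R) (v : 'cV[R]_p) i : 0 < eps ->
  `|(v - corner eps (cell eps v)) i 0| <= eps.
Proof.
move=> e0; rewrite !mxE; have /andP[lo hi] := floor_itv (v i 0 / eps).
move: lo hi; rewrite ler_pdivlMr // ltr_pdivrMr // intrD mulrDl mul1r => lo hi.
by rewrite ger0_norm ?subr_ge0 // lerBlDr addrC ltW.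
Qed.

Lemma measurable_cell (eps : R) (z : 'cV[int]_p) : 0 < eps ->
  measurable ([set v | cell eps v = z] : set (borel_cV R p)).
Proof.
move=> e0; have -> : [set v : borel_cV R p | cell eps v = z] =
    \bigcap_(i in [set: 'I_p]) (setT `&` (fun v : borel_cV R p => (v : 'cV[R]_p) i 0)
      @^-1` `[(z i 0)%:~R * eps, (z i 0 + 1)%:~R * eps[).
  apply/seteqP; split=> v /=.
    move=> <- i _; split=> //=; rewrite mxE in_itv /= -ler_pdivlMr // -ltr_pdivrMr //.
    exact: floor_itv.
  move=> H; apply/colP => i; rewrite mxE; have [_ /=] := H i I.
  by rewrite in_itv /= -ler_pdivlMr // -ltr_pdivrMr // => /floor_def.
apply: fin_bigcap_measurable => // i _.
by apply: measurable_cV_coord => //; exact: measurable_itv.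
Qed.

End borel_column_vectors.

(** * Normalized linear relations *)

Lemma max_coord (R : realDomainType) n (v : 'cV[R]_n) : v != 0 ->
  exists i, v i 0 != 0 /\ forall j, `|v j 0| <= `|v i 0|.
Proof.
case: n v => [v|n v v0]; first by rewrite flatmx0 eqxx.
pose i := [arg max_(i > ord0) `|v i 0|]%O.
have max_i j : `|v j 0| <= `|v i 0|.
  by rewrite /i; case: arg_maxP => // k _; apply.
exists i; split=> //; apply: contraNneq v0 => vi0; apply/eqP/colP => j.
by apply/eqP; rewrite mxE -normr_le0 -(normr0 R) -vi0.
Qed.

(** Divide by a coordinate of largest modulus. This bounds the coefficients of a relation from above
    and keeps the normals away from zero. *)
Lemma normalized_coord (R : realFieldType) n (v : 'cV[R]_n) : v != 0 ->
  exists i c, [/\ c != 0, (c *: v) i 0 = 1 & forall j, `|(c *: v) j 0| <= 1].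
Proof.
move=> /max_coord[i [vi0 vi]]; exists i, (v i 0)^-1; rewrite invr_eq0.
split=> [//||j]; rewrite mxE ?mulVf // normrM normfV mulrC.
by rewrite ler_pdivrMr ?normr_gt0 // mul1r.
Qed.

(** Replacing column [t] by zero makes the matrix singular; [u] is a normalized vector of its left
    kernel. *)
Lemma normal_to_others (R : realFieldType) n (g : 'I_n -> 'cV[R]_n) (t : 'I_n) :
  exists u : 'cV[R]_n, [/\ exists i, u i 0 = 1, forall j, `|u j 0| <= 1 &
    forall s, s != t -> u^T *m g s = 0].
Proof.
pose G := \matrix_(i, s) (if s == t then 0 else g s i 0).
have : \det G == 0.
  by rewrite (expand_det_col G t) big1 // => i _; rewrite mxE eqxx mul0r.
move=> /det0P[u u0 uG].
have [|i [c [c0 ui uj]]] := @normalized_coord _ _ u^T.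
  by rewrite -(inj_eq (@trmx_inj _ _ _)) trmxK trmx0.
exists (c *: u^T); split=> [|//|s st]; first by exists i.
rewrite linearZ /= trmxK -scalemxAl; suff -> : u *m g s = 0 by rewrite scaler0.
have /(congr1 (col s)) := uG; rewrite col0 => <-.
apply/matrixP => i' j'; rewrite !ord1 !mxE; apply: eq_bigr => k _.
by rewrite mxE (negbTE st).
Qed.

(** A common normal [v] makes the square matrix with rows [g s] singular, so these rows satisfy a
    linear relation, which is solved for the term with the largest coefficient. *)
Lemma dependent_columns (R : realFieldType) n (g : 'I_n -> 'cV[R]_n) (v : 'cV[R]_n) :
  v != 0 -> (forall s, (v^T *m g s) 0 0 = 0) ->
  exists t (al : 'I_n -> R), (forall s, `|al s| <= 1) /\
    g t = \sum_(s | s != t) al s *: g s.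
Proof.
move=> v0 vg; pose G := \matrix_(s, i) (g s i 0).
have : \det G == 0.
  rewrite -det_tr; apply/det0P; exists v^T.
    by rewrite -(inj_eq (@trmx_inj _ _ _)) trmxK trmx0.
  apply/rowP => s; rewrite [RHS]mxE -(vg s) !mxE; apply: eq_bigr => i _.
  by rewrite !mxE.
move=> /det0P[b b0 bG].
have [|t [c [c0 bt bs]]] := @normalized_coord _ _ b^T.
  by rewrite -(inj_eq (@trmx_inj _ _ _)) trmxK trmx0.
exists t, (fun s => - (c *: b^T) s 0); split=> [s|]; first by rewrite normrN.
have : \sum_s (c *: b^T) s 0 *: g s = 0.
  apply/colP => i; rewrite summxE [RHS]mxE.
  have /rowP/(_ i) := bG; rewrite !mxE => /(congr1 ( *%R c)); rewrite mulr0 mulr_sumr.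
  by apply: etrans; apply: eq_bigr => s _; rewrite !mxE mulrA.
rewrite (bigD1 t) //= bt scale1r => /eqP; rewrite addr_eq0 => /eqP ->.
by rewrite -sumrN; apply: eq_bigr => s _; rewrite scaleNr.
Qed.

Lemma dot_le (R : realDomainType) n (u r : 'cV[R]_n) (eps : R) :
  (forall i, `|u i 0| <= 1) -> (forall i, `|r i 0| <= eps) ->
  `|(u^T *m r) 0 0| <= n%:R * eps.
Proof.
move=> u1 re; rewrite mxE; apply: le_trans (ler_norm_sum _ _ _) _.
rewrite mulr_natl -[in leRHS](card_ord n) -sumr_const; apply: ler_sum => i _.
by rewrite mxE normrM -[leRHS]mul1r ler_pM.
Qed.

(** * Null sets and independent subfamilies *)

Lemma negligible_of_small (d : measure_display) (T : measurableType d)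
    (R : realType) (P : {measure set T -> \bar R}) (A : set T) :
  (forall e : R, 0 < e -> exists B, [/\ measurable B, (P B <= e%:E)%E & A `<=` B]) ->
  P.-negligible A.
Proof.
move=> small; have /choice[B HB] (k : nat) : exists B,
    [/\ measurable B, (P B <= (k.+1%:R^-1)%:E)%E & A `<=` B].
  by apply: small; rewrite invr_gt0.
(* The intersection of covers of measure at most [1/(k+1)] is a measurable null superset. *)
exists (\bigcap_k B k); split.
- by apply: bigcapT_measurable => k; have [] := HB k.
- apply/eqP; rewrite eq_le measure_ge0 andbT; apply/lee_addgt0Pr => e e0.
  have [k ke] := ltr_add_invr e0; rewrite add0e.
  have [mB PB _] := HB k; apply: (@le_trans _ _ (P (B k))).
    apply: le_measure; rewrite ?inE //; last by move=> w; apply.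
    by apply: bigcapT_measurable => j; have [] := HB j.
  by apply: le_trans PB _; rewrite lee_fin ltW // -[ltLHS]add0r.
- by move=> w Aw k _; have [_ _] := HB k; apply.
Qed.

(** Extend the family of events by the whole space outside the image of [h]; the added factors equal
    1. *)
Lemma mutually_independent_sub (d d' : measure_display) (T : measurableType d)
    (T' : measurableType d') (R : realType) (P : probability T R) (N M : nat)
    (X : 'I_N -> {RV P >-> T'}) (h : 'I_M -> 'I_N) :
  injective h -> mutually_independent X -> mutually_independent (X \o h).
Proof.
move=> hI indep B mB.
pose B' t := if [pick s | h s == t] is Some s then B s else setT.
have B'h s : B' (h s) = B s.
  rewrite /B'; case: pickP => [s' /eqP/hI -> //|/(_ s)].
  by rewrite eqxx.
have B'T t : t \notin [set h x | x in 'I_M]%SET -> B' t = setT.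
  rewrite /B'; case: pickP => [s' /eqP <-|//].
  by rewrite imset_f.
have mB' t : measurable (B' t) by rewrite /B'; case: pickP.
have := indep B' mB'; rewrite (bigID (mem [set h x | x in 'I_M]%SET)) /=.
rewrite [X in (_ * X)%E]big1 ?mule1 => [|t /B'T ->]; last first.
  by rewrite -[RHS](probability_setT P); congr (P _); apply/seteqP; split.
rewrite big_imset /=; last by move=> s s' _ _; exact: hI.
under eq_bigr do rewrite B'h.
move=> <-; congr (P _); apply/seteqP; split=> w /= Bw t; last first.
  by rewrite -B'h; exact: Bw.
have [/imsetP[s _ ->]|/B'T ->//] := boolP (t \in [set h x | x in 'I_M]%SET).
by rewrite B'h; exact: Bw.
Qed.

(** * Probability of a linear relation, by discretization *)

Section almost_surely_independent_columns.
Variables (d : measure_display) (T : measurableType d) (R : realType).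
Variables (P : probability T R) (p : nat) (y : 'I_p -> {RV P >-> borel_cV R p}).
Hypothesis indep : mutually_independent y.
Variable C : R.
(** [C] is uniform in the direction [u], since the normal varies with the grid configuration. *)
Hypothesis small_strips : forall t (u : 'cV[R]_p) (r : R), 0 < r ->
  (exists i, u i 0 = 1) -> (forall j, `|u j 0| <= 1) ->
  (P [set w | (`|(u^T *m (y t w : 'cV[R]_p)) 0 0| <= r)%R] <= (C * r)%:E)%E.

Section fixed_index.
Variables (t : 'I_p) (eps r : R).
Hypotheses (eps_gt0 : 0 < eps) (r_gt0 : 0 < r).

Implicit Types (z : {ffun 'I_p -> 'cV[int]_p}) (u : 'cV[R]_p) (B : set (borel_cV R p)).

(* Coordinate [t] is not discretized; it is filled with [0]. *)
Let Z (w : T) : {ffun 'I_p -> 'cV[int]_p} :=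
  [ffun s => if s == t then 0 else cell eps (y s w : 'cV[R]_p)].

Let strip (u : 'cV[R]_p) : set (borel_cV R p) :=
  [set v | `|(u^T *m (v : 'cV[R]_p)) 0 0| <= r].

Let box z B (s : 'I_p) : set (borel_cV R p) :=
  if s == t then B else [set v | cell eps (v : 'cV[R]_p) = z s].

Let mbox z B s : measurable B -> measurable (box z B s).
Proof. by rewrite /box; case: ifP => // _ _; exact: measurable_cell. Qed.

(** This puts the event in the product form to which [mutually_independent] applies; [z t] must be
    the filler value 0. *)
Let ZE z B : z t = 0 ->
  [set w | Z w = z] `&` [set w | B (y t w)] =
  [set w | forall s, box z B s (y s w)].
Proof.
rewrite /box => zt; apply/seteqP; split=> w /= => [[<- Bw] s|Bw].
  by case: (eqVneq s t) => [->//|st] /=; rewrite ffunE (negbTE st).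
split; last by have := Bw t; rewrite eqxx.
apply/ffunP => s; rewrite ffunE; case: (eqVneq s t) (Bw s) => [->|_]; by rewrite ?zt.
Qed.

Let ZN z : z t != 0 -> [set w | Z w = z] = set0.
Proof.
move=> zt; apply/seteqP; split=> // w /= Zw; move: zt.
by rewrite -Zw ffunE eqxx eqxx.
Qed.

Let mZ z B : measurable B -> measurable ([set w | Z w = z] `&` [set w | B (y t w)]).
Proof.
move=> mB; have [zt|/ZN ->] := eqVneq (z t) 0; last by rewrite set0I.
rewrite ZE //.
rewrite (_ : [set w | _] = \bigcap_(s in [set: 'I_p]) (y s @^-1` box z B s)); last first.
  by apply/seteqP; split=> w /= Bw s; [move=> _|]; exact: Bw.
apply: fin_bigcap_measurable => // s _; rewrite -[X in measurable X]setTI.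
by apply: measurable_funP => //; exact: mbox.
Qed.

Let mZ1 z : measurable [set w | Z w = z].
Proof.
by have := @mZ z setT measurableT; rewrite (_ : [set w | setT (y t w)] = setT) ?setIT.
Qed.

(** By independence both probabilities are products with the same factors at [s != t]. The factor at
    [t] is at most [C * r] on the left and is 1 on the right. *)
Let strip_cell_le z u : (exists i, u i 0 = 1) -> (forall j, `|u j 0| <= 1) ->
  (P ([set w | Z w = z] `&` [set w | strip u (y t w)]) <=
   (C * r)%:E * P [set w | Z w = z])%E.
Proof.
move=> u1 uj; have [zt|/ZN ->] := eqVneq (z t) 0; last by rewrite set0I measure0 mule0.
have -> : [set w | Z w = z] = [set w | Z w = z] `&` [set w | setT (y t w)].
  by apply/seteqP; split=> w //= [].
(* The trivial condition is wanted on the right only; on the left it is absorbed by the strip. *)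
rewrite setIAC -setIA.
rewrite (_ : _ `&` [set w | setT _] = [set w | strip u (y t w)]); last first.
  by apply/seteqP; split=> w //= [].
rewrite !ZE // (indep (B := box z (strip u))); last first.
  by move=> s; apply: mbox; exact: measurable_strip.
rewrite (indep (B := box z setT)); last by move=> s; exact: mbox.
rewrite (bigD1 t) // [in leRHS](bigD1 t) //= {1 3}/box eqxx.
rewrite (_ : [set w | setT _] = setT) // probability_setT mul1e.
set A := (\prod_(_ < _ | _) _)%E; set A' := (\prod_(_ < _ | _) _)%E.
have -> : A' = A by apply: eq_bigr => s st; rewrite /box (negbTE st).
apply: lee_wpmul2r; last exact: small_strips.
by apply: prode_ge0 => s _; exact: measure_ge0.
Qed.

Lemma dependent_event_cover : p%:R * (p%:R * eps) <= r ->
  exists B : set T, [/\ measurable B, (P B <= (C * r)%:E)%E &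
    [set w | exists al : 'I_p -> R, (forall s, `|al s| <= 1) /\
       (y t w : 'cV[R]_p) = \sum_(s | s != t) al s *: (y s w : 'cV[R]_p)] `<=` B].
Proof.
move=> eps_r.
have /choice[u Hu] (z : {ffun 'I_p -> 'cV[int]_p}) :=
  normal_to_others (fun s => corner eps (z s)) t.
(* Configurations are indexed by their codes in [nat]; a number that codes none gives empty events.
   The sets [A n] are disjoint, so the bounds [C * r * P (A n)] sum to at most [C * r]. *)
pose A n := [set w | pickle (Z w) = n].
pose F n := A n `&` [set w | strip (u (Z w)) (y t w)].
have AFE n : (A n = set0 /\ F n = set0) \/ exists z, A n = [set w | Z w = z] /\
    F n = [set w | Z w = z] `&` [set w | strip (u z) (y t w)].
  have [[z zn]|nz] := pselect (exists z : {ffun 'I_p -> 'cV[int]_p}, pickle z = n).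
    have AE : A n = [set w | Z w = z].
      apply/seteqP; split=> w /=; last by rewrite /A /= => ->.
      by rewrite /A /= -zn => /(pcan_inj pickleK).
    right; exists z; split=> //; rewrite /F AE; apply/seteqP.
    by split=> w /= [Zw]; rewrite -Zw.
  have A0 : A n = set0 by apply/seteqP; split=> // w Aw; apply: nz; exists (Z w).
  by left; rewrite /F A0 set0I.
have mA n : measurable (A n) by have [[-> _]|[z [-> _]]] := AFE n.
have mF n : measurable (F n).
  by have [[_ ->]|[z [_ ->]]] := AFE n => //; apply: mZ; exact: measurable_strip.
(* The sign of [C] is not assumed; it follows because [C * r] bounds a probability. *)
have C0 : 0 <= C * r.
  have [[i ui] uj _] := Hu [ffun=> 0].
  have := small_strips t r_gt0 (ex_intro _ i ui) uj.
  by rewrite -lee_fin; apply: le_trans; exact: measure_ge0.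
exists (\bigcup_n F n); split; first exact: bigcupT_measurable.
  have mUF : measurable (\bigcup_n F n) by exact: bigcupT_measurable.
  apply: le_trans (measure_sigma_subadditive P mF mUF (@subset_refl _ _)) _.
  apply: (@le_trans _ _ (\sum_(n <oo) (C * r)%:E * P (A n))%E).
    apply: lee_nneseries => // n _.
    have [[_ ->]|[z [-> ->]]] := AFE n; first by rewrite measure0 mule_ge0 // lee_fin.
    by have [u1 uj _] := Hu z; exact: strip_cell_le.
  rewrite nneseriesZl // -[leRHS]mule1; apply: lee_wpmul2l; first by rewrite lee_fin.
  rewrite -measure_semi_bigcup //; last exact: bigcupT_measurable.
    by apply: probability_le1; exact: bigcupT_measurable.
  apply/trivIsetP => i j _ _ ij; apply/seteqP; split=> // w [/= Ai Aj].
  by move: ij; rewrite -Ai -Aj eqxx.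
move=> w [al [al1 ytE]]; exists (pickle (Z w)) => //; split=> //=.
have [_ uj uz] := Hu (Z w); rewrite /strip /= ytE.
(* The normal kills the corners, so only rounding errors remain: at most [p] terms, each at most
   [p * eps]. *)
have -> : (u (Z w))^T *m (\sum_(s | s != t) al s *: (y s w : 'cV[R]_p)) =
    \sum_(s | s != t) al s *: ((u (Z w))^T *m
      ((y s w : 'cV[R]_p) - corner eps (cell eps (y s w : 'cV[R]_p)))).
  rewrite mulmx_sumr; apply: eq_bigr => s st; rewrite -scalemxAr mulmxBr.
  by have := uz s st; rewrite ffunE (negbTE st) => ->; rewrite subr0.
rewrite summxE; apply: le_trans (ler_norm_sum _ _ _) _; apply: le_trans eps_r.
rewrite mulr_natl -[X in _ <= _ *+ X]card_ord -sumr_const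
  [leRHS](bigID (fun s => s != t)) /=.
rewrite ler_wpDr ?sumr_ge0 // => [s _|]; first by rewrite mulr_ge0 // ltW.
apply: ler_sum => s _; rewrite mxE normrM -[leRHS]mul1r ler_pM //.
by apply: dot_le => // i; exact: cell_corner_le.
Qed.

End fixed_index.

Lemma negligible_dependent : P.-negligible [set w | exists v : 'cV[R]_p,
  v != 0 /\ forall s, (v^T *m (y s w : 'cV[R]_p)) 0 0 = 0].
Proof.
pose D (t : 'I_p) := [set w | exists al : 'I_p -> R, (forall s, `|al s| <= 1) /\
  (y t w : 'cV[R]_p) = \sum_(s | s != t) al s *: (y s w : 'cV[R]_p)].
have D0 t : P.-negligible (D t).
  apply: negligible_of_small => e e0.
  (* These give [C * r <= e] and [p * p * eps <= r]; the added 1 keeps the denominators positive. *)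
  pose r := e / (`|C| + 1); pose eps := r / (p%:R * p%:R + 1).
  have C1 : 0 < `|C| + 1 by rewrite ltr_wpDl.
  have p1 : 0 < p%:R * p%:R + 1 :> R by rewrite ltr_wpDl // mulr_ge0.
  have r0 : 0 < r by rewrite divr_gt0.
  have eps0 : 0 < eps by rewrite divr_gt0.
  have [|B [mB PB DB]] := @dependent_event_cover t eps r eps0 r0.
    rewrite mulrA -[leRHS](divfK (lt0r_neq0 p1)) -/eps mulrC.
    by rewrite ler_pM2l // lerDl.
  exists B; split=> //; apply: le_trans PB _; rewrite lee_fin.
  rewrite -[leRHS](divfK (lt0r_neq0 C1)) -/r mulrC ler_pM2l //.
  by rewrite (le_trans (ler_norm _)) // lerDl.
pose F n := if insub n is Some t then D t else set0.
apply: (@negligibleS _ _ _ _ (\bigcup_n F n)).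
  move=> w [v [v0 vy]].
  have [t [al al_t]] := dependent_columns v0 vy.
  by exists (val t) => //; rewrite /F valK; exists al.
apply: negligible_bigcup => n; rewrite /F; case: insub => //.
exact: negligible_set0.
Qed.

End almost_surely_independent_columns.

(** * Gaussian vectors *)

(** The density is at most its peak [1 / sqrt (2 pi s^2) <= 1 / c], and the interval has length
    [2 r]. *)
Lemma normal_prob_itv_le (R : realType) (s r c : R) : 0 < c -> c <= s -> 0 < r ->
  (normal_prob 0 s `[(- r)%R, r]%classic <= (2 / c * r)%:E)%E.
Proof.
move=> c0 cs r0; have s0 : 0 < s by exact: lt_le_trans cs.
have peak_le : normal_peak s <= c^-1.
  rewrite lef_pV2 ?posrE // ?sqrtr_gt0; last first.
    by rewrite mulrn_wgt0 // mulr_gt0 ?pi_gt0 // exprn_gt0.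
  rewrite -[c]ger0_norm ?(ltW c0) // -sqrtr_sqr ler_sqrt.
    rewrite (@le_trans _ _ (s ^+ 2)) ?ler_sqr ?nnegrE ?(ltW c0) ?(ltW s0) //.
    rewrite -mulrnAr ler_peMr ?sqr_ge0 //.
    by have := pi_ge2 R; lra.
  by rewrite mulrn_wge0 // mulr_ge0 ?sqr_ge0 ?pi_ge0.
rewrite /normal_prob.
apply: (@le_trans _ _
  (\int[lebesgue_measure]_(x in `[(- r)%R, r]%classic) cst (c^-1)%:E x)%E).
  apply: ge0_le_integral => //=.
  - by move=> x _; rewrite lee_fin normal_pdf_ge0.
  - apply/measurable_EFinP; apply: measurable_funTS; exact: measurable_normal_pdf.
  - move=> x _; rewrite lee_fin; apply: le_trans peak_le.
    by apply: normal_pdf_ub; rewrite gt_eqF.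
rewrite integral_cst //= lebesgue_measure_itv /= lte_fin gtrN // -EFinB -EFinM lee_fin.
by rewrite opprK le_eqVlt; apply/orP; left; apply/eqP; ring.
Qed.

(** With [N = A^(1/2) M] the form is the squared norm of [N u]. Since [u = N^-1 (N u)] has a
    coordinate 1, this norm is at least [1 / K], where [K] dominates the absolute row sums of
    [N^-1]. *)
Lemma form_lower_bound (R : realType) n (A M : 'M[R]_n) :
  spd A -> M \in unitmx -> exists c : R, 0 < c /\
  forall u : 'cV[R]_n, (exists i, u i 0 = 1) ->
    c ^+ 2 <= ((M *m u)^T *m A *m (M *m u)) 0 0.
Proof.
move=> sA Mu; have [sB BE] := sqrtmxP sA.
pose N := sqrtmx A *m M.
have Nu : N \in unitmx by rewrite unitmx_mul Mu spd_unitmx.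
pose K := 1 + \sum_i \sum_j `|invmx N i j|.
have K_ge i : \sum_j `|invmx N i j| <= K.
  rewrite /K [in leRHS](bigD1 i) //= addrCA lerDl addr_ge0 // sumr_ge0 // => k _.
  exact: sumr_ge0.
have K0 : 0 < K by rewrite ltr_wpDr // sumr_ge0 // => i _; exact: sumr_ge0.
exists K^-1; split=> [|u [i ui]]; first by rewrite invr_gt0.
have -> : (M *m u)^T *m A *m (M *m u) = (N *m u)^T *m (N *m u).
  by rewrite -BE /N !trmx_mul (spd_sym sB) !mulmxA.
set q := (_ *m _) 0 0; have q0 : 0 <= q by exact: dotv_ge0.
have Nle j : `|(N *m u) j 0| <= Num.sqrt q.
  rewrite -sqrtr_sqr ler_sqrt // /q [leRHS]mxE (bigD1 j) //= [(_^T) _ _]mxE -expr2.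
  by rewrite lerDl sumr_ge0 // => k _; rewrite mxE -expr2 sqr_ge0.
suff : 1 <= K * Num.sqrt q.
  move=> Kq; rewrite -(sqr_sqrtr q0) ler_sqr ?nnegrE ?sqrtr_ge0 ?invr_ge0 ?(ltW K0) //.
  by rewrite -div1r ler_pdivrMr // mulrC.
have <- : `|u i 0| = 1 by rewrite ui normr1.
rewrite -[u in leLHS](mulKmx Nu) mxE; apply: le_trans (ler_norm_sum _ _ _) _.
apply: (@le_trans _ _ (\sum_j `|invmx N i j| * Num.sqrt q)).
  by apply: ler_sum => j _; rewrite normrM ler_wpM2l.
by rewrite -mulr_suml ler_wpM2r ?sqrtr_ge0.
Qed.

(** The form at [v] is the mean of the squares of the products of [v] with the samples. *)
Lemma sample_cov_spd (R : realType) (p N : nat) (y : 'I_N -> 'cV[R]_p) :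
  (0 < N)%N ->
  (forall v : 'cV[R]_p, v != 0 -> exists t, (v^T *m y t) 0 0 != 0) ->
  spd (sample_cov y).
Proof.
move=> N0 y_span; split.
  apply/symmetricmxP; rewrite /sample_cov linearZ /= raddf_sum /=.
  by congr (_ *: _); apply: eq_bigr => t _; rewrite trmx_mul trmxK.
move=> v v0; have [t vt] := y_span v v0.
have -> : (v^T *m sample_cov y *m v) 0 0 =
    N%:R^-1 * \sum_t (v^T *m y t) 0 0 ^+ 2.
  rewrite /sample_cov -scalemxAr -scalemxAl mxE; congr (_ * _).
  rewrite mulmx_sumr mulmx_suml summxE; apply: eq_bigr => s _.
  have -> : v^T *m (y s *m (y s)^T) *m v = (v^T *m y s) *m (v^T *m y s)^T.
    by rewrite trmx_mul trmxK !mulmxA.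
  by rewrite mxE big_ord1 [X in _ * X]mxE expr2.
rewrite mulr_gt0 ?invr_gt0 ?ltr0n // (bigD1 t) //= ltr_wpDr //.
  by apply: sumr_ge0 => s _; exact: sqr_ge0.
by rewrite exprn_even_gt0.
Qed.

(** The product of [u] with [M x] is the linear form of [x] along [M^T u], a centered normal
    variable whose variance is at least [c^2] for all admissible [u]. *)
Lemma gaussian_strip_le (R : realType) (p : nat) (Theta M : 'M[R]_p)
    (d : measure_display) (T : measurableType d) (P : probability T R)
    (x : {RV P >-> borel_cV R p}) :
  spd Theta -> gaussian_vector x 0 (invmx Theta) -> M \in unitmx ->
  exists C : R, forall (u : 'cV[R]_p) (r : R), 0 < r -> (exists i, u i 0 = 1) ->
    (P [set w | (`|(u^T *m (M *m (x w : 'cV[R]_p))) 0 0| <= r)%R] <= (C * r)%:E)%E.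
Proof.
move=> sTheta hx Mu.
have Mtu : M^T \in unitmx by rewrite unitmx_tr.
have [c [c0 cu]] := form_lower_bound (spd_inv sTheta) Mtu.
exists (2 / c) => u r r0 u1.
have uM v : u^T *m (M *m v) = (M^T *m u)^T *m v by rewrite trmx_mul trmxK mulmxA.
have -> : [set w | `|(u^T *m (M *m (x w : 'cV[R]_p))) 0 0| <= r] =
    [set w | `[(- r)%R, r]%classic (((M^T *m u)^T *m (x w : 'cV[R]_p)) 0 0)].
  by apply/seteqP; split=> w /=; rewrite uM in_itv /= ler_norml.
rewrite hx; last exact: measurable_itv.
have := cu u u1; set q := (_ *m _) 0 0 => cq.
have q0 : 0 < q by apply: lt_le_trans cq; rewrite exprn_gt0.
rewrite /normal_law gt_eqF // mulmx0 mxE; apply: normal_prob_itv_le => //.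
by rewrite -[c]ger0_norm ?(ltW c0) // -sqrtr_sqr ler_sqrt // ltW.
Qed.

Theorem mainTheorem1
  (R : realType) (p N : nat) (hp : (1 <= p)%N) (hN : (p < N)%N)
  (E : rel 'I_p.+1) (a : 'M[R]_p.+1)
  (hgraph : weighted_graph E a) (hconn : connected_graph E)
  (Lstar : 'M[R]_p) (hLstar : Lstar = reduced_laplacian a)
  (Theta : 'M[R]_p) (hTheta : spd Theta)
  (d' : measure_display) (Omega' : measurableType d')
  (P' : probability Omega' R) (x : {RV P' >-> borel_cV R p})
  (hx : gaussian_vector x 0 (invmx Theta))
  (d : measure_display) (Omega : measurableType d)
  (P : probability Omega R) (y : 'I_N -> {RV P >-> borel_cV R p})
  (hindep : mutually_independent y)
  (hlaw : forall (t : 'I_N) (A : set (borel_cV R p)), measurable A ->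
     P [set w | A (y t w)] =
     P' [set w | A (invmx Lstar *m (x w : 'cV[R]_p))]) :
  {ae P, forall w : Omega,
    let S := sample_cov (fun t => y t w : 'cV[R]_p) in
    let Sh := sqrtmx S in
    spd S /\
    unique (global_minimizer (@spd R p) (mle_objective S Theta))
      (invmx Sh *m sqrtmx (Sh *m invmx Theta *m Sh) *m invmx Sh)}.
Proof.
have Lu : invmx Lstar \in unitmx.
  by rewrite unitmx_inv hLstar; exact: reduced_laplacian_unitmx hgraph hconn.
have [C small_strip] := gaussian_strip_le hTheta hx Lu.
(* The first [p] samples already span the space almost surely. *)
pose h := widen_ord (ltnW hN).
have hI : injective h by move=> i j /(congr1 val) /= /val_inj.
have dep0 := @negligible_dependent _ _ _ _ _ (y \o h) (mutually_independent_sub hI hindep) C.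
apply: negligibleS (dep0 _) => [w /= bad|t u r r0 u1 _]; last first.
  by have := hlaw (h t) _ (measurable_strip u r) => /= ->; exact: small_strip.
apply: contrapT => indep_w; apply: bad.
have sS : spd (sample_cov (fun t => y t w : 'cV[R]_p)).
  apply: sample_cov_spd; first exact: leq_ltn_trans (leq0n p) hN.
  move=> v v0; apply: contrapT => vy; apply: indep_w; exists v; split=> // s.
  by apply/eqP; apply: contrapT => /negP vs; apply: vy; exists (h s).
by split=> //; exact: mle_unique_minimizer.
Qed.
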